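(* Let $n\ge1$. If $f(x_1,\dots,x_n;\mathbf t)\in\mathrm{EQSym}_n$ and $\sigma\in\mathrm{NC}_n$, then $\mathrm{ev}_\sigma f=\mathrm{ev}_{\mathrm{id}}f$. In particular, if $c$ is a nonempty padded composition of length $n$ (i.e. $c\neq(0^n)$), then $\mathrm{ev}_\sigma\mathfrak F_c=0$ for all $\sigma\in\mathrm{NC}_n$.
   Context: $\mathbf x=(x_1,x_2,\dots)$, $\mathbf t=(t_1,t_2,\dots)$. For $f\in\mathbb Z[\mathbf t][\mathbf x]$: $R_i^-f=f(x_1,\dots,x_{i-1},t_i,x_i,\dots;\mathbf t)$, $R_i^+f=f(x_1,\dots,x_i,t_i,x_{i+1},\dots;\mathbf t)$, $E_if=(R_i^+f-R_i^-f)/(x_i-t_i)$. $\mathrm{EQSym}_n=\{f\in\mathbb Z[\mathbf t][x_1,\dots,x_n]:R_i^+f=R_i^-f\text{ for }1\le i<n\}$. For a permutation $\sigma$, $\mathrm{ev}_\sigma f=f(t_{\sigma(1)},t_{\sigma(2)},\dots;\mathbf t)$. Noncrossing permutations: a set partition of $[n]$ is noncrossing if there are no distinct blocks $P,Q$ with $a,b\in P$, $c,d\in Q$ and $a<c<b<d$. To such a partition associate the permutation $\sigma\in S_n$ which on each block $\{a_1<\dots<a_p\}$ acts by $\sigma(a_j)=a_{j-1}$ for $j\ge2$ and $\sigma(a_1)=a_p$ (the cycle $(a_p\,a_{p-1}\cdots a_1)$). $\mathrm{NC}_n\subseteq S_n$ is the set of these permutations. Double fundamental polynomials: indexed forests are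 sequences $F=(T_1,T_2,\dots)$ of binary plane trees (each node a leaf or an internal node with ordered left/right children), all but finitely many being one-node trees, with leaves identified with $\mathbb N$ left to right; $\emptyset$ has no internal nodes; $\rho_F(v)$ is the leaf reached from internal node $v$ by repeatedly going to left children; a node is terminal if both children are leaves; $\mathrm{Qdes}(F)=\{\rho_F(v):v\text{ terminal}\}$; $F/i$ deletes the terminal node with $\rho_F(v)=i$ (replacing it and its leaves by one leaf, relabeling). The double forest polynomials $\mathfrak P_F(\mathbf x;\mathbf t)$ are the unique homogeneous family ($\deg x_i=\deg t_i=1$) with $\mathfrak P_F(\mathbf t;\mathbf t)=\delta_{F,\emptyset}$ and $E_i\mathfrak P_F=\mathfrak P_{F/i}(\mathbf x;\widehat{\mathbf t}_i)$ if $i\in\mathrm{Qdes}(F)$, else $0$, with $\widehat{\mathbf t}_i=(t_1,\dots,t_{i-1},t_{i+1},\dots)$. The code of $F$ is $(c_i)$ with $c_i=\#\{v:\rho_F(v)=i\}$. A padded composition of length $n$ is $c=(0^{n-\ell},a_1,\dots,a_\ell)$, $\ell\ge0$, $a_i>0$; $F_c$ is the forest with code $c$ (followed by zeros) and $\mathfrak F_c(x_1,\dots,x_n;\mathbf t):=\mathfrak P_{F_c}(\mathbf x;\mathbf t)$, which lies in $\mathrm{EQSym}_n$. *)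

(* Defs.v *)
From HB Require Import structures.
From mathcomp Require Import all_boot all_order all_algebra all_fingroup.
From mathcomp Require Import finmap.
From mathcomp Require Import monalg.

Set Implicit Arguments.
Unset Strict Implicit.
Unset Printing Implicit Defensive.

Import GRing.Theory.
Local Open Scope ring_scope.

(* The ring Z[x_1,x_2,...; t_1,t_2,...].                               *)
(* Variables: [inl i] is x_i, [inr j] is t_j (1-based; index 0 is     *)
(* never used by the polynomials we consider).                         *)
Definition var := (nat + nat)%type.
Definition Pol := {malg int[{cmonom var}]}.

Definition X (v : var) : Pol := << ucm v >>.
Definition x (i : nat) : Pol := X (inl i).
Definition t (j : nat) : Pol := X (inr j).

Definition subst (s : var -> Pol) (g : Pol) : Pol :=
  mmap (fun c : int => c%:~R : Pol)
       (fun m : {cmonom var} => \prod_(v <- finsupp m) s v ^+ m v) g.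

Definition occurs (v : var) (g : Pol) : bool :=
  [exists m : msupp g, (v \in finsupp (val m))].

Definition in_Zt_xn (n : nat) (g : Pol) : Prop :=
  forall v, occurs v g ->
    match v with inl i => (1 <= i <= n)%N | inr j => (1 <= j)%N end.

Definition in_Zxt (g : Pol) : Prop :=
  forall v, occurs v g ->
    match v with inl i => (1 <= i)%N | inr j => (1 <= j)%N end.

Definition homogeneous (g : Pol) : Prop :=
  exists d, forall m : {cmonom var}, m \in msupp g -> mdeg m = d.

Definition Rminus (i : nat) (f : Pol) : Pol :=
  subst (fun v => match v with
                  | inl j => if (j < i)%N then x j else if j == i then t i else x j.-1
                  | inr j => t j end) f.

Definition Rplus (i : nat) (f : Pol) : Pol :=
  subst (fun v => match v with
                  | inl j => if (j <= i)%N then x j else if j == i.+1 then t i else x j.-1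
                  | inr j => t j end) f.

(* E_i f = g, i.e. g = (R_i^+ f - R_i^- f)/(x_i - t_i) (exact division) *)
Definition Ediv_is (i : nat) (f g : Pol) : Prop :=
  (x i - t i) * g = Rplus i f - Rminus i f.

Definition EQSym (n : nat) (f : Pol) : Prop :=
  in_Zt_xn n f /\ forall i : nat, (1 <= i < n)%N -> Rplus i f = Rminus i f.

Definition ev (n : nat) (s : 'S_n) (f : Pol) : Pol :=
  subst (fun v => match v with
                  | inl j => match @insub nat (fun k => (k < n)%N) 'I_n j.-1 with
                             | Some k => if (1 <= j)%N then t (s k).+1 else x j
                             | None => x j end
                  | inr j => t j end) f.

Definition at_t (f : Pol) : Pol :=
  subst (fun v => match v with inl j => t j | inr j => t j end) f.

Definition that (i : nat) (f : Pol) : Pol :=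
  subst (fun v => match v with
                  | inl j => x j
                  | inr j => if (j < i)%N then t j else t j.+1 end) f.

Definition noncrossing (n : nat) (P : {set {set 'I_n}}) : bool :=
  [forall B1 in P, forall B2 in P, (B1 != B2) ==>
     ~~ [exists a in B1, exists b in B1, exists c in B2, exists d in B2,
           [&& (a < c)%N, (c < b)%N & (b < d)%N]]].

Definition nc_fun (n : nat) (P : {set {set 'I_n}}) (y : 'I_n) : 'I_n :=
  let s := sort (fun a b : 'I_n => (a <= b)%N) (enum (pblock P y)) in
  let j := index y s in
  if j == 0%N then last y s else nth y s j.-1.

Definition NC (n : nat) (s : 'S_n) : Prop :=
  exists P : {set {set 'I_n}},
    [/\ partition P [set: 'I_n], noncrossing P & forall y, s y = nc_fun P y].

Inductive btree := Leaf | Node of btree & btree.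

Definition is_leaf (T : btree) : bool := if T is Leaf then true else false.

Fixpoint nleaves (T : btree) : nat :=
  match T with Leaf => 1%N | Node l r => (nleaves l + nleaves r)%N end.

(* An indexed forest (T_1, T_2, ...) is represented by the finite list of
   its trees up to the last nontrivial one (all further trees are leaves);
   this representation is unique for "normal" lists. *)
Definition forest := seq btree.
Definition normal_forest (F : forest) : bool :=
  if F is [::] then true else ~~ is_leaf (last Leaf F).

Definition trim (F : forest) : forest :=
  rev (drop (find (fun T => ~~ is_leaf T) (rev F)) (rev F)).

(* code: number of internal nodes v of T with rho(v) = i, where o is the
   label of the leftmost leaf of T *)
Fixpoint code_tree (T : btree) (o i : nat) : nat :=
  match T with
  | Leaf => 0%N
  | Node l r => ((i == o) + code_tree l o i + code_tree r (o + nleaves l) i)%N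
  end.

Fixpoint qdes_tree (T : btree) (o i : nat) : bool :=
  match T with
  | Leaf => false
  | Node Leaf Leaf => i == o
  | Node l r => qdes_tree l o i || qdes_tree r (o + nleaves l) i
  end.

Fixpoint del_tree (T : btree) (o i : nat) : btree :=
  match T with
  | Leaf => Leaf
  | Node Leaf Leaf => if i == o then Leaf else T
  | Node l r => Node (del_tree l o i) (del_tree r (o + nleaves l) i)
  end.

(* forest versions; leaves are labelled 1, 2, 3, ... from left to right *)
Fixpoint code_from (F : forest) (o i : nat) : nat :=
  match F with [::] => 0%N | T :: F' => (code_tree T o i + code_from F' (o + nleaves T) i)%N end.
Fixpoint qdes_from (F : forest) (o i : nat) : bool :=
  match F with [::] => false | T :: F' => qdes_tree T o i || qdes_from F' (o + nleaves T) i end.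
Fixpoint del_from (F : forest) (o i : nat) : forest :=
  match F with [::] => [::] | T :: F' => del_tree T o i :: del_from F' (o + nleaves T) i end.

Definition code (F : forest) (i : nat) : nat := code_from F 1 i.
Definition Qdes (F : forest) (i : nat) : bool := qdes_from F 1 i.
Definition fdel (F : forest) (i : nat) : forest := trim (del_from F 1 i).

Definition double_forest_family (P : forest -> Pol) : Prop :=
  forall F : forest, normal_forest F ->
    [/\ in_Zxt (P F), homogeneous (P F),
        at_t (P F) = (if F is [::] then 1 else 0)
      & forall i : nat, (1 <= i)%N ->
          Ediv_is i (P F) (if Qdes F i then that i (P (fdel F i)) else 0)].

Definition padded_composition (n : nat) (c : seq nat) : bool :=
  (size c == n) && [exists k : 'I_n.+1, all (fun a => a == 0%N) (take k c) &&
                                       all (fun a => (0 < a)%N) (drop k c)].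

Definition has_code (F : forest) (c : seq nat) : Prop :=
  forall i : nat, (1 <= i)%N -> code F i = nth 0%N c i.-1.

(* Main.v *)
Require Import Defs.
From HB Require Import structures.
From mathcomp Require Import all_boot all_order all_algebra all_fingroup.
From mathcomp Require Import finmap.
From mathcomp Require Import monalg.
From mathcomp Require Import zify.

(* Evaluating f in EQSym_n at words in the variables t_1, t_2, ..., the relation
   R_i^+ f = R_i^- f says that the letters at positions i and i+1 may be exchanged
   whenever one of them is t_i.  In a noncrossing permutation other than the
   identity, choose b with sigma(b) = a < b and b - a minimal: noncrossingness
   makes every position strictly between a and b fixed, and exchanges then turn
   the word of sigma into that of sigma (a b), the noncrossing permutation in
   which a has been removed from its block.  Induction on the number of
   non-fixed points ends at the identity.
   For a padded composition c of length n, the only possible element of Qdes(F_c)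
   is n, since i in Qdes(F) forces c_i > 0 and c_{i+1} = 0.  Hence E_i kills P_{F_c}
   for i <> n; the indices i > n show that no x_j with j > n occurs, the others
   give membership in EQSym_n, and the value at the identity is P_{F_c}(t;t) = 0. *)

Set Implicit Arguments.
Unset Strict Implicit.
Unset Printing Implicit Defensive.

Import GRing.Theory.
Local Open Scope ring_scope.

Implicit Types (s : var -> Pol) (f g h : Pol) (u v : var).

(** * Substitution as a ring morphism, and the variables occurring in a polynomial *)

Definition monom_subst (s : var -> Pol) (m : {cmonom var}) : Pol :=
  \prod_(v <- finsupp m) s v ^+ m v.

(** Allows products over different supports to be compared over one common finite set. *)
Lemma monom_substEw (s : var -> Pol) (m : {cmonom var}) (d : {fset var}) :
  (finsupp m `<=` d)%fset -> monom_subst s m = \prod_(v <- d) s v ^+ m v.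
Proof.
move=> le_md; rewrite /monom_subst; apply: big_fset_incl => // v _ vNm.
by rewrite -cmE_eq0 in vNm; rewrite (eqP vNm).
Qed.

Lemma monom_subst_mmorphism (s : var -> Pol) : mmorphism (monom_subst s).
Proof.
split=> [m1 m2|]; last by rewrite /monom_subst mdom1 big_seq_fset0.
pose d := (finsupp m1 `|` finsupp m2)%fset.
rewrite (@monom_substEw s (mmul m1 m2) d) ?mdomD //.
rewrite (@monom_substEw s m1 d) ?fsubsetUl // (@monom_substEw s m2 d) ?fsubsetUr //.
by rewrite -big_split; apply: eq_bigr => v _ /=; rewrite cmM exprD.
Qed.

HB.instance Definition _ s := isMultiplicative.Build _ _ _ (monom_subst_mmorphism s).

Definition substr (s : var -> Pol) : {rmorphism Pol -> Pol} :=
  mmap (intr : int -> Pol) (monom_subst s).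

Lemma subst_rmorphE s g : subst s g = substr s g.
Proof. by []. Qed.

Lemma substE s g :
  subst s g = \sum_(m <- msupp g) (g@_m)%:~R * monom_subst s m.
Proof. by []. Qed.

Lemma eq_subst s1 s2 g :
  (forall v, occurs v g -> s1 v = s2 v) -> subst s1 g = subst s2 g.
Proof.
move=> eq_s; rewrite !substE; apply: eq_big_seq => m m_g.
suff -> : monom_subst s1 m = monom_subst s2 m by [].
rewrite /monom_subst; apply: eq_big_seq => v v_m; rewrite eq_s //.
by apply/existsP; exists [` m_g]%fset.
Qed.

Lemma subst_comp s1 s2 g :
  subst s1 (subst s2 g) = subst (fun v => subst s1 (s2 v)) g.
Proof.
rewrite [subst s1 _]subst_rmorphE [subst s2 g]substE rmorph_sum substE.
apply: eq_bigr => m _; rewrite rmorphM rmorph_int.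
suff -> : substr s1 (monom_subst s2 m) = monom_subst (fun v => subst s1 (s2 v)) m by [].
by rewrite /monom_subst rmorph_prod; apply: eq_bigr => v _; rewrite rmorphXn.
Qed.

Lemma malgUM (m1 m2 : {cmonom var}) : << m1 >> * << m2 >> = << mmul m1 m2 >> :> Pol.
Proof. by rewrite malgM_def fgmulUU mulr1. Qed.

Lemma X_expE u k : exists mk : {cmonom var},
  X u ^+ k = << mk >> /\ forall v, mk v = ((u == v) * k)%N.
Proof.
elim: k => [|k [mk [mkX mkE]]].
  by exists mone; rewrite expr0; split=> // v; rewrite cm1 muln0.
exists (mmul (ucm u) mk); split=> [|v]; last by rewrite cmM mkE cmU mulnS.
rewrite exprS mkX; exact: malgUM.
Qed.

Lemma monom_subst_X (m : {cmonom var}) : monom_subst X m = << m >>.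
Proof.
(* Exponents are cut off outside a list, so that induction can run over the enumeration of the
   support. *)
suff [mm [-> mmE]] : exists mm : {cmonom var},
    monom_subst X m = << mm >> /\
    forall v, mm v = if v \in enum_fset (finsupp m) then m v else 0%N.
  congr << _ >>; apply/eqP/cmP => v; rewrite mmE -/(v \in finsupp m).
  by case: mdomP.
rewrite /monom_subst; move: (fset_uniq (finsupp m)).
elim: (enum_fset (finsupp m)) => [|u r IHr] /=.
  by move=> _; exists mone; rewrite big_nil; split=> // v; rewrite cm1.
case/andP=> uNr /IHr [mm [mmX mmE]]; rewrite big_cons mmX.
have [mk [-> mkE]] := X_expE u (m u); exists (mmul mk mm); split=> [|v].
  exact: malgUM.
rewrite cmM mkE mmE in_cons eq_sym; case: eqVneq => [->|_] /=; last by rewrite mul0n.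
by rewrite (negPf uNr) mul1n addn0.
Qed.

Lemma subst_X s v : subst s (X v) = s v.
Proof.
rewrite subst_rmorphE /= mmapU mul1r.
by rewrite /monom_subst mdomU big_seq_fset1 cmUU.
Qed.

Lemma subst_id g : subst X g = g.
Proof.
rewrite substE [RHS]monalgE; apply: eq_bigr => m _.
have -> : << g@_m *g m >> = g@_m *: (<< m >> : Pol).
  by rewrite -mul_malgC malgM_def fgmulUU mulr1 mul1m.
by rewrite -monom_subst_X -mul_malgC -[g@_m in RHS]intz rmorph_int.
Qed.

Lemma occursP v g : reflect (exists2 m, m \in msupp g & v \in finsupp m) (occurs v g).
Proof.
apply: (iffP existsP) => [[m v_m]|[m m_g v_m]]; first by exists (val m); rewrite ?(valP m).
by exists [` m_g]%fset.
Qed.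

Lemma occurs_X v w : occurs v (X w) = (v == w).
Proof.
have XE : msupp (X w) = [fset ucm w]%fset by rewrite /X msuppU1.
apply/occursP/eqP => [[m]|->]; last first.
  by exists (ucm w); [rewrite XE fset11 | rewrite mdomU fset11].
by rewrite XE => /fset1P ->; rewrite mdomU => /fset1P.
Qed.

Lemma occursD v g h : occurs v (g + h) -> occurs v g || occurs v h.
Proof.
case/occursP=> m /(fsubsetP (msuppD_le _ _)); rewrite inE => /orP[] m_g v_m; apply/orP.
  by left; apply/occursP; exists m.
by right; apply/occursP; exists m.
Qed.

Lemma occursM v g h : occurs v (g * h) -> occurs v g || occurs v h.
Proof.
case/occursP=> m /msuppM_le [m1 [m2 [m1g m2h ->]]].
rewrite mdomD inE => /orP[] v_m; apply/orP.
  by left; apply/occursP; exists m1.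
by right; apply/occursP; exists m2.
Qed.

Lemma occurs_int v (c : int) : ~~ occurs v (c%:~R).
Proof.
have -> : c%:~R = c%:MP :> Pol by rewrite -[c in RHS]intz rmorph_int.
apply/occursP => -[m] /(fsubsetP (msuppC_le _)); rewrite inE => /eqP ->.
by rewrite mdom1 inE.
Qed.

(** The claim [Q] holds for integer constants and is stable under sums and products, from which the
    substituted polynomial is built. *)
Lemma occurs_subst v s g :
  occurs v (subst s g) -> exists2 w, occurs w g & occurs v (s w).
Proof.
move=> occ; pose Q (h : Pol) := occurs v h -> exists2 w, occurs w g & occurs v (s w).
suff : Q (subst s g) by apply.
have QM h1 h2 : Q h1 -> Q h2 -> Q (h1 * h2).
  by move=> Q1 Q2 /occursM /orP[].
have Qint (c : int) : Q (c%:~R) by move=> h; have := occurs_int v c; rewrite h.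
rewrite substE big_seq; apply: (big_ind Q) => [|h1 h2 Q1 Q2|m m_g].
- exact: (Qint 0).
- by move/occursD/orP => [].
apply: (QM); first exact: (Qint).
rewrite /monom_subst big_seq; apply: (big_ind Q) => [|h1 h2|w w_m].
- exact: (Qint 1).
- exact: QM.
elim: (m w) => [|k IHk]; first exact: (Qint 1).
by rewrite exprS; apply: (QM) => // occ_w; exists w => //; apply/occursP; exists m.
Qed.

(* Conversion tests that unfold these do not terminate in practice. *)
#[local] Opaque X subst.

(** * Evaluation at words of variables and exchange of adjacent letters *)

HB.lock Definition at_vars (z : nat -> var) (f : Pol) : Pol :=
  subst (fun v => match v with inl j => X (z j) | inr j => t j end) f.

Lemma eq_at_vars z1 z2 f : z1 =1 z2 -> at_vars z1 f = at_vars z2 f.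
Proof. by move=> eq_z; rewrite at_vars.unlock; apply: eq_subst => -[] j _; rewrite ?eq_z. Qed.

Lemma at_vars_Rplus z i f : at_vars z (Rplus i f) =
  at_vars (fun j => if (j <= i)%N then z j else if j == i.+1 then inr i else z j.-1) f.
Proof.
rewrite at_vars.unlock; apply: (etrans (subst_comp _ _ _)).
apply: eq_subst => -[] j _; last by rewrite subst_X.
by case: (j <= i)%N; [|case: (j == i.+1)]; rewrite subst_X.
Qed.

Lemma at_vars_Rminus z i f : at_vars z (Rminus i f) =
  at_vars (fun j => if (j < i)%N then z j else if j == i then inr i else z j.-1) f.
Proof.
rewrite at_vars.unlock; apply: (etrans (subst_comp _ _ _)).
apply: eq_subst => -[] j _; last by rewrite subst_X.
by case: (j < i)%N; [|case: (j == i)]; rewrite subst_X.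
Qed.

Definition swap_at (i : nat) (z : nat -> var) (j : nat) : var :=
  if j == i then z i.+1 else if j == i.+1 then z i else z j.

(* Evaluate R_i^+ f = R_i^- f at the word z with its i-th letter removed. *)
Lemma at_vars_swap (i : nat) (z : nat -> var) f :
  Rplus i f = Rminus i f -> z i = inr i -> at_vars (swap_at i z) f = at_vars z f.
Proof.
move=> Rf zi; pose y j := if (j < i)%N then z j else z j.+1.
have E := etrans (etrans (esym (at_vars_Rplus y i f)) (congr1 (at_vars y) Rf))
  (at_vars_Rminus y i f).
(* Inserting [inr i] after the [i]-th letter of [y] gives the swapped word; inserting it before that
   letter gives [z] back. *)
apply: etrans (etrans _ E) _; apply: eq_at_vars => j; rewrite {E Rf} /y /swap_at -zi.
  do !case: ifP => //; try lia; move=> *; congr z; lia.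
do !case: ifP => //; try lia; move=> *; congr z; lia.
Qed.

Definition shift (a b : nat) (z : nat -> var) (j : nat) : var :=
  if j == a then z b else if (a < j <= b)%N then z j.-1 else z j.

(** The letter at [b] travels left by exchanges at [b - 1], ..., [a]; when it reaches position
    [i.+1], position [i] still holds [inr i]. *)
Lemma at_vars_shift n f (a b : nat) (z : nat -> var) :
  EQSym n f -> (1 <= a)%N -> (a <= b <= n)%N ->
  (forall i, (a <= i < b)%N -> z i = inr i) -> at_vars (shift a b z) f = at_vars z f.
Proof.
move=> [_ Rf] a1 abn; have [d bE] : exists d, b = (a + d)%N by exists (b - a)%N; lia.
rewrite {b}bE in abn *; elim: d z abn => [|d IHd] z abn zt.
  apply: eq_at_vars => j; rewrite /shift addn0.
  by do !case: ifP => //; try lia; move=> /eqP ->.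
rewrite -[RHS](@at_vars_swap (a + d)); first last.
- by apply: zt; lia.
- by apply: Rf; lia.
rewrite -[RHS]IHd; first last.
- by move=> i ai; rewrite /swap_at; do 2![case: ifP; first lia]; move=> *; apply: zt; lia.
- by lia.
apply: eq_at_vars => j; rewrite /shift /swap_at !eqxx addnS.
do !case: ifP => //; try lia; move=> *; congr z; lia.
Qed.

(** * Noncrossing equivalence relations and their cyclic maps *)

Section NoncrossingCycles.
Variable n : nat.
Implicit Types (e : rel 'I_n) (w : 'I_n -> 'I_n) (a b c d i j k : 'I_n).

Definition eqv_rel e := [/\ reflexive e, symmetric e & transitive e].

Definition noncrossing_rel e :=
  forall a b c d, (a < c)%N -> (c < b)%N -> (b < d)%N -> e a b -> e c d -> e a c.

Definition pred_in_class e w k :=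
  (w k < k)%N /\ forall j, (w k < j < k)%N -> ~~ e j k.

Definition min_to_max e w k := forall j, e j k -> (k <= j <= w k)%N.

(** A list-free description of the cycles of the noncrossing permutation: each point goes to its
    predecessor in its class, the minimum to the maximum. *)
Definition cyclic_pred e w :=
  forall k, e (w k) k /\ (pred_in_class e w k \/ min_to_max e w k).

Definition isolate a e : rel 'I_n := fun i j => (i == j) || [&& i != a, j != a & e i j].

(** When [a = w b], this is [w] composed with the transposition of [a] and [b]. *)
Definition bypass a b w k := if k == a then a else if k == b then w a else w k.

Lemma isolate_eqv a e : eqv_rel e -> eqv_rel (isolate a e).
Proof.
case=> e_refl e_sym e_trans; split=> [i|i j|j i k]; rewrite /isolate ?eqxx //.
  by rewrite eq_sym e_sym andbCA.
case: eqVneq => [->//|_] /= /and3P[ia ja eij].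
case: eqVneq => [<-|_] /=; first by rewrite ia ja eij orbT.
by case/and3P=> _ ka ejk; rewrite ia ka (e_trans _ _ _ eij ejk) orbT.
Qed.

Lemma isolate_sub a e i j : reflexive e -> isolate a e i j -> e i j.
Proof. by move=> e_refl /orP[/eqP->|/and3P[]]. Qed.

Lemma isolate_noncrossing a e :
  eqv_rel e -> noncrossing_rel e -> noncrossing_rel (isolate a e).
Proof.
case=> e_refl e_sym e_trans nc_e p q c d pc cq qd /orP[/eqP pq|]; first by subst q; lia.
case/and3P=> pa qa epq /orP[/eqP cd|]; first by subst d; lia.
case/and3P=> ca da ecd; apply/orP; right; rewrite pa ca.
exact: nc_e pc cq qd epq ecd.
Qed.

(** An ascent starts only at a class minimum, so [w k] is the class maximum and the next step is a
    descent inside the class. *)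
Lemma cyclic_pred_max e w k :
  eqv_rel e -> cyclic_pred e w -> (k < w k)%N -> (w (w k) < w k)%N /\ (k <= w (w k))%N.
Proof.
case=> e_refl e_sym e_trans cyc lt_k.
have [ek [[]|kmin]] := cyc k; first by lia.
have [ewk [[lt_wk _]|wkmin]] := cyc (w k).
  by have := kmin _ (e_trans _ _ _ ewk ek); lia.
by have := wkmin k; rewrite e_sym => /(_ ek); lia.
Qed.

(* For a step b -> w b of minimal length: by noncrossingness a non-fixed point strictly
   between w b and b would have its whole class there, hence a shorter step. *)
Lemma innermost_step e w k :
  eqv_rel e -> noncrossing_rel e -> cyclic_pred e w -> w k != k ->
  exists b, [/\ (w b < b)%N, forall j, (w b < j < b)%N -> w j = j & w (w b) != w b].
Proof.
move=> eqv_e nc_e cyc wk; have [e_refl e_sym e_trans] := eqv_e.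
have [b0 lt_b0] : exists b, (w b < b)%N.
  case: (ltngtP (w k) k) => [lt_k|lt_k|/val_inj eq_k]; last by rewrite eq_k eqxx in wk.
    by exists k.
  by exists (w k); have [] := cyclic_pred_max eqv_e cyc lt_k.
have [b lt_b min_b] := @arg_minnP _ b0 (fun b => (w b < b)%N) (fun b => (b - w b)%N) lt_b0.
have [eb [[_ b_next]|bmin]] := cyc b; last by have := bmin _ (e_refl b); lia.
exists b; split=> // [j ajb|]; last first.
  apply/eqP => wa; have [_ [[lt_a _]|amin]] := cyc (w b).
    by rewrite wa ltnn in lt_a.
  by have := amin b; rewrite e_sym wa => /(_ eb); lia.
have Nejb := b_next _ ajb; have [ej _] := cyc j.
case: (ltngtP (w j) j) => [lt_j|lt_j|/val_inj //]; case/negP: Nejb.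
  (* A descent at [j] is no shorter than the one at [b], so [w j < w b < j < b] and the two pairs
     cross. *)
  have := min_b _ lt_j => le_bj.
  have ewa : e (w j) (w b) by apply: (nc_e _ j _ b) => //; lia.
  by rewrite e_sym in ej; exact: e_trans ej (e_trans _ _ _ ewa eb).
(* For an ascent at [j], the descent from [w j] is no shorter than the one at [b], so [w j] cannot
   lie left of [b]; if it lies beyond, the pairs cross. *)
have [lt_wj le_wj] := cyclic_pred_max eqv_e cyc lt_j.
have := min_b _ lt_wj => le_bj.
case: (ltngtP (w j) b) => [|lt_b_wj|/val_inj eq_b]; first by lia.
  rewrite e_sym in ej.
  have eaj : e (w b) j by apply: (nc_e _ b _ (w j)) => //; lia.
  by rewrite e_sym in eaj; exact: e_trans eaj eb.
by rewrite e_sym -eq_b.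
Qed.

(** Once [w b] leaves its class, [b] inherits its role: either [w (w b)] is the new predecessor of
    [b], or [b] is the new minimum and [w (w b)] is still the maximum. *)
Lemma bypass_cyclic e w b :
  eqv_rel e -> cyclic_pred e w -> (w b < b)%N ->
  cyclic_pred (isolate (w b) e) (bypass (w b) b w).
Proof.
move=> [e_refl e_sym e_trans] cyc lt_b k; set a := w b in lt_b *.
have sub_e := isolate_sub (a := a) e_refl.
have [eab [[_ b_next]|bmin]] := cyc b; last by have := bmin _ (e_refl b); rewrite -/a; lia.
rewrite -/a in b_next.
rewrite /bypass; case: (eqVneq k a) => [->|ka].
  split; first by rewrite /isolate eqxx.
  by right=> j; rewrite /isolate eqxx andbF orbF => /eqP ->; rewrite leqnn.
have [ea wa] := cyc a; case: (eqVneq k b) => [->|kb].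
  have ba : b != a by apply/eqP => ba; rewrite ba ltnn in lt_b.
  have ewb : e (w a) b := e_trans _ _ _ ea eab.
  case: wa => [[lt_a a_next]|amin].
    have waa : w a != a by apply/eqP => waa; rewrite waa ltnn in lt_a.
    split; first by rewrite /isolate waa ba ewb orbT.
    left; rewrite /pred_in_class (negPf ba) eqxx; split; first by lia.
    move=> j jb; apply/negP => ejb; case/orP: (ejb) => [/eqP jE|/and3P[ja _ _]].
      by rewrite jE ltnn andbF in jb.
    move/sub_e: ejb => ejb; case: (ltngtP j a) => [lt_j|lt_j|/val_inj jE].
    - rewrite e_sym in eab; case/negP: (a_next j ltac:(lia)).
      exact: e_trans ejb eab.
    - by case/negP: (b_next j ltac:(lia)).
    - by rewrite jE eqxx in ja.
  have eba : e b a by rewrite e_sym.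
  have ebw := amin _ eba.
  have waa : w a != a by apply/eqP => waa; rewrite waa in ebw; lia.
  split; first by rewrite /isolate waa ba ewb orbT.
  right=> j; rewrite (negPf ba) eqxx => ejb.
  case/orP: (ejb) => [/eqP -> //|/and3P[ja _ _]]; first by lia.
  move/sub_e: ejb => ejb; have eja := e_trans _ _ _ ejb eba.
  have := amin _ eja => /andP[le_aj le_jw].
  case: (ltngtP j a) => [|lt_j|/val_inj jE]; [lia | | by rewrite jE eqxx in ja].
  case: (leqP b j) => [|lt_jb]; first by lia.
  by case/negP: (b_next j ltac:(lia)).
have [ek ck] := cyc k.
(* Only [b] maps to [a]: of two points with predecessor [a], the smaller would lie strictly between
   [a] and the larger. *)
have wka : w k != a.
  apply/eqP => wka; rewrite wka in ek.
  have ebk : e b k by rewrite e_sym in eab; exact: e_trans eab ek.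
  case: ck => [[lt_k k_next]|kmin]; last by have := kmin _ ebk; rewrite wka; lia.
  rewrite wka in lt_k k_next.
  case: (ltngtP k b) => [lt_kb|lt_bk|/val_inj kE]; last by rewrite kE eqxx in kb.
    by case/negP: (b_next k ltac:(lia)); rewrite e_sym.
  by case/negP: (k_next b ltac:(lia)).
split; first by rewrite /isolate wka ka ek orbT.
case: ck => [[lt_k k_next]|kmin]; [left|right].
  rewrite /pred_in_class (negPf ka) (negPf kb); split=> // j /k_next.
  by apply: contra => /sub_e.
by move=> j /sub_e /kmin; rewrite (negPf ka) (negPf kb).
Qed.

End NoncrossingCycles.

(** * From set partitions to equivalence relations *)

Definition same_block n (P : {set {set 'I_n}}) : rel 'I_n :=
  fun i j => pblock P i == pblock P j.

(** In the sorted duplicate-free list of a block, index 0 is the minimum and [last] the maximum; no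
    block element lies between consecutive entries. *)
Lemma nc_fun_cyclic n (P : {set {set 'I_n}}) :
  partition P [set: 'I_n] -> cyclic_pred (same_block P) (nc_fun P).
Proof.
case/and3P=> /eqP covP triP _ k.
have in_own j : j \in pblock P j by rewrite mem_pblock covP inE.
have inB j : (j \in pblock P k) = (pblock P j == pblock P k).
  by apply/idP/eqP => [/(same_pblock triP) // | <-].
rewrite /nc_fun; set leo := (fun a b : 'I_n => _).
set s := sort leo (enum (pblock P k)).
have mem_s j : (j \in s) = (pblock P j == pblock P k) by rewrite mem_sort mem_enum inB.
have uniq_s : uniq s by rewrite sort_uniq enum_uniq.
have leo_refl : reflexive leo by move=> i; exact: leqnn.
have leo_trans : transitive leo by move=> j i l; exact: leq_trans.
have s_sorted : sorted leo s by apply: sort_sorted => i j; exact: leq_total.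
have le_nth (i j : nat) : (i <= j)%N -> (j < size s)%N -> (nth k s i <= nth k s j)%N.
  move=> le_ij lt_js; apply: (sorted_leq_nth leo_trans leo_refl k s_sorted) => //.
  exact: leq_ltn_trans lt_js.
have ks : k \in s by rewrite mem_s.
have lt_ks : (index k s < size s)%N by rewrite index_mem.
have ne_s : (0 < size s)%N by apply: leq_ltn_trans lt_ks.
case: eqP => [k0|/eqP k0].
  have lastE : last k s = nth k s (size s).-1 by rewrite nth_last.
  split; first by rewrite /same_block -mem_s lastE mem_nth // prednK.
  right=> j; rewrite /same_block -mem_s => js.
  have lt_js : (index j s < size s)%N by rewrite index_mem.
  have nth0 : nth k s 0 = k by rewrite -k0 nth_index.
  have jE : nth k s (index j s) = j := nth_index k js.
  have le_k := le_nth 0%N (index j s) isT lt_js.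
  have le_last := le_nth (index j s) (size s).-1 ltac:(lia) ltac:(lia).
  by rewrite jE nth0 in le_k; rewrite jE -lastE in le_last; rewrite k0 eqxx le_k.
have kE : nth k s (index k s) = k := nth_index k ks.
have k_gt0 : (0 < index k s)%N by rewrite lt0n.
have lt_p : ((index k s).-1 < size s)%N by lia.
split; first by rewrite /same_block -mem_s mem_nth.
left; rewrite /pred_in_class -/s (negPf k0); split.
  have le_pk := le_nth (index k s).-1 (index k s) (leq_pred _) lt_ks; rewrite kE in le_pk.
  rewrite ltn_neqAle le_pk andbT; apply/eqP => /val_inj/eqP.
  by rewrite -[X in _ == X]kE nth_uniq // => /eqP; lia.
move=> j /andP[lt_pj lt_jk]; rewrite /same_block -mem_s; apply/negP => js.
have lt_js : (index j s < size s)%N by rewrite index_mem.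
have jE : nth k s (index j s) = j := nth_index k js.
case: (leqP (index k s) (index j s)) => [le_kj|lt_jk'].
  by have := le_nth _ _ le_kj lt_js; rewrite jE kE; lia.
have := le_nth (index j s) (index k s).-1 ltac:(lia) lt_p; rewrite jE; lia.
Qed.

Lemma noncrossing_pblock n (P : {set {set 'I_n}}) :
  partition P [set: 'I_n] -> noncrossing P ->
  noncrossing_rel (same_block P).
Proof.
case/and3P=> /eqP covP triP _ ncP a b c d ac cb bd /eqP ab /eqP cd.
have in_own j : j \in pblock P j by rewrite mem_pblock covP inE.
have inP j : pblock P j \in P by rewrite pblock_mem // covP inE.
move/forall_inP: ncP => /(_ _ (inP a)) /forall_inP /(_ _ (inP c)) /implyP ncP.
apply/negPn/negP => /ncP /negP[].
apply/existsP; exists a; rewrite in_own; apply/existsP; exists b; rewrite ab in_own.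
apply/existsP; exists c; rewrite in_own; apply/existsP; exists d.
by rewrite cd in_own ac cb bd.
Qed.

(** * Words of permutations and invariance of the evaluation *)

Definition word_var n (w : 'I_n -> 'I_n) (j : nat) : var :=
  match @insub nat (fun k => (k < n)%N) 'I_n j.-1 with
  | Some k => if (1 <= j)%N then inr (w k).+1 else inl j
  | None => inl j
  end.

Lemma word_varS n (w : 'I_n -> 'I_n) (k : 'I_n) : word_var w k.+1 = inr (w k).+1.
Proof. by rewrite /word_var /= valK. Qed.

Lemma word_var_out n (w1 w2 : 'I_n -> 'I_n) (j : nat) :
  (1 <= j <= n)%N = false -> word_var w1 j = word_var w2 j.
Proof.
move=> jn; rewrite /word_var; case: insubP => [k lt_jn _|_]; last reflexivity.
(* Since [0.-1] is [0], index 0 may pass [insub]; only the test [1 <= j] excludes it. *)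
by case: ifP => [j1|_]; [exfalso; lia | reflexivity].
Qed.

Lemma evE n (s : 'S_n) f : ev s f = at_vars (word_var s) f.
Proof.
rewrite at_vars.unlock; apply: eq_subst => -[] j _ //; rewrite /word_var.
by case: insub => [k|]; [case: (1 <= j)%N|].
Qed.

(* With u = w (w b), both words restricted to the positions from w b to b are
   rotated by at_vars_shift to (u, w b, w b + 1, ..., b - 1). *)
Lemma at_vars_bypass n f (w : 'I_n -> 'I_n) (b : 'I_n) :
  EQSym n f -> (w b < b)%N -> (forall j : 'I_n, (w b < j < b)%N -> w j = j) ->
  at_vars (word_var w) f = at_vars (word_var (bypass (w b) b w)) f.
Proof.
move=> EQf lt_b fix_w; set w' := bypass _ _ _; have bn := ltn_ord b.
have w'a : w' (w b) = w b by rewrite /w' /bypass eqxx.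
have w'b : w' b = w (w b).
  by rewrite /w' /bypass eqxx ifN //; apply/eqP => bE; rewrite -bE ltnn in lt_b.
have w'E k : k != w b -> k != b -> w' k = w k.
  by move=> ka kb; rewrite /w' /bypass (negPf ka) (negPf kb).
(* Ordinal [k] sits at position [k.+1]. The fixed stretch of [w] starts just after [w b], hence
   [.+2]; that of [w'] includes [w b], hence [.+1] below. *)
rewrite -[LHS](@at_vars_shift n f (w b).+2 b.+1 _ EQf isT); first last.
- case=> // i ib; have lt_in : (i < n)%N by lia.
  by rewrite -[i]/(val (Ordinal lt_in)) word_varS fix_w //=; lia.
- lia.
rewrite -[RHS](@at_vars_shift n f (w b).+1 b.+1 _ EQf isT); first last.
- case=> // i ib; have lt_in : (i < n)%N by lia.
  rewrite -[i]/(val (Ordinal lt_in)) word_varS; congr (inr _.+1).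
  case: (eqVneq (Ordinal lt_in) (w b)) => [->|ia]; first by rewrite w'a.
  have ia' : i != w b by apply: contra ia => /eqP ia; apply/eqP/val_inj.
  rewrite w'E //; last by apply/eqP => iE; rewrite -iE /= in ib; lia.
  by rewrite fix_w //=; lia.
- lia.
apply: eq_at_vars => j {EQf}; rewrite /shift.
case: (boolP (1 <= j <= n)%N) => [jn|/negPf jn]; last first.
  by do ![case: ifP; first lia]; move=> *; apply: word_var_out.
case: j jn => // j jn; have lt_jn : (j < n)%N by lia.
rewrite -[j]/(val (Ordinal lt_jn)); move: (Ordinal lt_jn) => k {j jn lt_jn}.
rewrite !eqSS /=.
case: (ltngtP k (w b)) => [lt_k|lt_k|/val_inj ->].
- do ![case: ifP; first lia]; move=> *; rewrite !word_varS w'E //.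
    by apply/eqP => kE; rewrite kE ltnn in lt_k.
  by apply/eqP => kE; rewrite kE in lt_k; lia.
- case: (leqP k b) => [le_kb|lt_kb]; last first.
    do ![case: ifP; first lia]; move=> *; rewrite !word_varS w'E //.
      by apply/eqP => kE; rewrite kE ltnn in lt_k.
    by apply/eqP => kE; rewrite kE ltnn in lt_kb.
  (* Beyond [w b] and up to [b], both rotated words carry at [k] the letter of [k.-1]. *)
  have lt_pn : (k.-1 < n)%N by lia.
  pose k' := Ordinal lt_pn; have -> : val k = k'.+1 by rewrite /=; lia.
  have le_ak' : (w b <= k')%N by rewrite /=; lia.
  have lt_k'b : (k' < b)%N by rewrite /=; lia.
  move: k' le_ak' lt_k'b => k' le_ak' lt_k'b {lt_pn k lt_k le_kb}.
  case: (eqVneq k' (w b)) => [->|k'a].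
    by do 2![case: ifP; try lia]; move=> *; rewrite !word_varS w'a.
  have lt_ak' : (w b < k')%N by rewrite ltn_neqAle eq_sym -val_eqE le_ak' andbT in k'a *.
  have k'b : k' != b by apply/eqP => k'E; rewrite k'E ltnn in lt_k'b.
  by do ![case: ifP; try lia]; move=> *; rewrite !word_varS w'E // fix_w //; lia.
- by do 2![case: ifP => [?|_]; first lia]; rewrite !word_varS w'b.
Qed.

(** Stated for a relation and a map, so that the induction hypothesis applies directly to [isolate]
    and [bypass]. *)
Lemma at_vars_noncrossing n f (e : rel 'I_n) (w : 'I_n -> 'I_n) :
  EQSym n f -> eqv_rel e -> noncrossing_rel e -> cyclic_pred e w ->
  at_vars (word_var w) f = at_vars (word_var (@id 'I_n)) f.
Proof.
move=> EQf; have [m] := ubnP #|[pred k | w k != k]|.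
elim: m e w => [|m IHm] e w lt_m eqv_e nc_e cyc; first by rewrite ltn0 in lt_m.
case: (pickP [pred k | w k != k]) => [k /= wk | w_id]; last first.
  apply: eq_at_vars => j; rewrite /word_var; case: insubP => // k _ _.
  by have /negbFE/eqP -> := w_id k.
have [b [lt_b fix_w wa]] := innermost_step eqv_e nc_e cyc wk.
apply: etrans (at_vars_bypass EQf lt_b fix_w) _; apply: (IHm (isolate (w b) e)).
- apply: leq_trans (_ : _ < #|[pred k | w k != k]|)%N lt_m.
  (* The point [w b] is moved by [w] but no longer by [bypass], and no new point becomes moved. *)
  apply/proper_card/properP; split; last by exists (w b); rewrite !inE ?/bypass ?eqxx.
  apply/subsetP => j; rewrite !inE /bypass.
  case: (eqVneq j (w b)) => [->|_]; first by rewrite eqxx.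
  by case: (eqVneq j b) => [-> _|//]; apply/eqP => wb; rewrite wb ltnn in lt_b.
- exact: isolate_eqv.
- exact: isolate_noncrossing.
- exact: bypass_cyclic.
Qed.

Lemma ev_noncrossing n f (s : 'S_n) : EQSym n f -> NC s -> ev s f = ev (1%g : 'S_n) f.
Proof.
move=> EQf [P [partP ncP sE]].
have ev1 : ev (1%g : 'S_n) f = at_vars (word_var (@id 'I_n)) f.
  apply: etrans (evE _ _) _; apply: eq_at_vars => j; rewrite /word_var.
  by case: insubP => // k _ _; rewrite perm1.
apply: etrans (evE s f) (etrans _ (esym ev1)).
apply: (at_vars_noncrossing EQf (e := same_block P)).
- split=> [i|i j|j i k]; rewrite /same_block; [exact: eqxx|exact: eq_sym|].
  by move/eqP ->.
- exact: noncrossing_pblock.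
by move=> k; have := nc_fun_cyclic partP k; rewrite /pred_in_class /min_to_max sE.
Qed.

(** * Codes and terminal nodes of forests *)

Lemma nleaves_gt0 T : (0 < nleaves T)%N.
Proof. by elim: T => //= l IHl r IHr; rewrite addn_gt0 IHl. Qed.

(** An internal node has a right subtree, so its leftmost leaf is never the last leaf of the tree;
    hence the strict bound on [i.+1]. *)
Lemma code_tree_support T o i :
  code_tree T o i != 0%N -> (o <= i)%N && (i.+1 < o + nleaves T)%N.
Proof.
elim: T o => //= l IHl r IHr o.
have := nleaves_gt0 l; have := nleaves_gt0 r.
have [->|/IHr {IHr}] := eqVneq (code_tree r (o + nleaves l) i) 0%N; last by lia.
have [->|/IHl {IHl}] := eqVneq (code_tree l o i) 0%N; last by lia.
by case: (eqVneq i o) => [->|_] //=; lia.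
Qed.

(* A right leaf starts no leftmost path, so it carries no internal node. *)
Lemma qdes_tree_code T o i :
  qdes_tree T o i -> code_tree T o i != 0%N /\ code_tree T o i.+1 = 0%N.
Proof.
elim: T o => // l IHl r IHr o q.
have {q} [io|[ql|qr]] : (i = o /\ l = Leaf /\ r = Leaf) \/
    (qdes_tree l o i \/ qdes_tree r (o + nleaves l) i).
- case: l r {IHl IHr} q => [|l1 l2] [|r1 r2] q; try by right; apply/orP.
  by left; split; first exact/eqP.
- by case: io => -> [-> ->] /=; rewrite eqxx; split=> //; case: eqP => //; lia.
- have [cl cl1] := IHl _ ql; have := code_tree_support cl.
  have := @code_tree_support r (o + nleaves l) i.+1.
  case: eqP => [cr1 _|_ /(_ isT)]; last by lia.
  by move=> oi /=; rewrite cl1 cr1; split; [|case: eqP]; lia.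
have [cr cr1] := IHr _ qr; have := code_tree_support cr.
have := @code_tree_support l o i.+1.
case: eqP => [cl1 _|_ /(_ isT)]; last by lia.
by move=> oi /=; rewrite cl1 cr1; split; [|case: eqP]; lia.
Qed.

Lemma code_from_support F o i : code_from F o i != 0%N -> (o <= i)%N.
Proof.
elim: F o => //= T F IHF o.
have [->|/IHF {IHF}] := eqVneq (code_from F (o + nleaves T) i) 0%N; last by lia.
by rewrite addn0 => /code_tree_support; lia.
Qed.

Lemma qdes_from_code F o i :
  qdes_from F o i -> code_from F o i != 0%N /\ code_from F o i.+1 = 0%N.
Proof.
elim: F o => //= T F IHF o /orP[/qdes_tree_code [c c1]|/IHF [c c1]].
  have := code_tree_support c; have := @code_from_support F (o + nleaves T) i.+1.
  by case: eqP => [->|_ /(_ isT)]; lia.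
have := code_from_support c; have := @code_tree_support T o i.+1.
by case: eqP => [->|_ /(_ isT)]; lia.
Qed.

Lemma Qdes_padded n c F i :
  padded_composition n c -> has_code F c -> (1 <= i)%N -> Qdes F i -> i = n.
Proof.
case/andP=> /eqP size_c /existsP[k /andP[c0 c1]] codeF i1 /qdes_from_code [].
rewrite -/(code F i) -/(code F i.+1) !codeF //= => ci ci1.
(* The default 0 of [nth] stands for the entries past the end, so a nonzero entry lies within the
   length. *)
have lt_in : (i.-1 < n)%N.
  by rewrite -size_c ltnNge; apply: contra ci => le_c; rewrite nth_default.
have le_ki : (k <= i.-1)%N.
  rewrite leqNgt; apply: contra ci => lt_ik; move/all_nthP: c0 => /(_ 0%N i.-1).
  rewrite nth_take // => -> //; rewrite size_take size_c; case: ifP; lia.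
case: (ltngtP i n) => [lt_i|lt_i|//]; last by lia.
(* Index [i - k] of the positive tail is entry [i] of [c] counted from 0, that is, the code at
   [i.+1]. *)
move/all_nthP: c1 => /(_ 0%N (i - k)%N); rewrite size_drop size_c nth_drop.
rewrite subnKC ?ci1; last by lia.
by move=> /(_ ltac:(lia)).
Qed.

(** * Double forest polynomials of padded compositions *)

Lemma x_occurs_bounded f : exists N, forall j, occurs (inl j) f -> (j <= N)%N.
Proof.
pose idx v : nat := match v with inl j | inr j => j end.
pose top (m : {cmonom var}) := (\max_(v <- finsupp m) idx v)%N.
exists (\max_(m <- msupp f) top m)%N => j /occursP [m m_f v_m].
have le_top : (top m <= \max_(m <- msupp f) top m)%N := leq_bigmax_seq _ m_f isT.
have le_j : (idx (inl j) <= top m)%N := leq_bigmax_seq _ v_m isT.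
exact: leq_trans le_j le_top.
Qed.

(* If x_M is the last variable of f, then R_M^+ f = f while R_M^- f is free of x_M. *)
Lemma x_occurs_le n f :
  (forall i, (n < i)%N -> Rplus i f = Rminus i f) ->
  forall j, occurs (inl j) f -> (j <= n)%N.
Proof.
move=> Rf; have [N leN] := x_occurs_bounded f.
have [d leNd] : exists d, (N <= n + d)%N by exists N; lia.
have {N leN leNd} : forall j, occurs (inl j) f -> (j <= n + d)%N.
  by move=> j /leN; lia.
elim: d => [|d IHd] le_f; first by move=> j /le_f; rewrite addn0.
apply: IHd => j occ_j; have := le_f _ occ_j; rewrite leq_eqVlt addnS ltnS.
case/orP=> // /eqP jM; exfalso.
have fE : Rplus j f = f.
  rewrite -[RHS]subst_id; apply: eq_subst => -[] i // /le_f le_i.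
  by rewrite ifT //; lia.
rewrite -fE Rf in occ_j; last by lia.
have [[i|i] occ_i] := occurs_subst occ_j; last by rewrite occurs_X.
have := le_f _ occ_i => le_i.
by do ![case: ifP => ?]; rewrite occurs_X // => /eqP[]; lia.
Qed.

Lemma double_forest_EQSym n (P : forest -> Pol) c F :
  double_forest_family P -> padded_composition n c -> normal_forest F -> has_code F c ->
  EQSym n (P F).
Proof.
move=> dfP pad_c nF codeF; have [Zxt _ _ EF] := dfP F nF.
have RF i : (1 <= i)%N -> i != n -> Rplus i (P F) = Rminus i (P F).
  move=> i1 iNn; have := EF i i1; rewrite /Ediv_is ifN ?mulr0; last first.
    by apply: contra iNn => /(Qdes_padded pad_c codeF i1) ->.
  by move/esym/eqP; rewrite subr_eq0 => /eqP.
split=> [v occ_v|i lt_in]; last by apply: RF; lia.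
have := Zxt v occ_v; case: v occ_v => // j occ_j ->.
by apply: (x_occurs_le _ occ_j) => i lt_ni; apply: RF; lia.
Qed.

(** The two substitutions differ only on [x j] with [j] outside [1..n], and these do not occur in
    [f]. *)
Lemma ev1_at_t n f : in_Zt_xn n f -> ev (1%g : 'S_n) f = at_t f.
Proof.
move=> Zf; apply: eq_subst => -[] // j /Zf jn.
have lt_jn : (j.-1 < n)%N by lia.
by rewrite insubT perm1 /= ifT; [congr t; lia | lia].
Qed.

Theorem theorem7p1 (n : nat) (hn : (1 <= n)%N) :
  (forall (f : Pol) (s : 'S_n), EQSym n f -> NC s -> ev s f = ev (1%g : 'S_n) f) /\
  (forall P : forest -> Pol, double_forest_family P ->
     forall c : seq nat, padded_composition n c -> has (fun a => a != 0%N) c ->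
     forall F : forest, normal_forest F -> has_code F c ->
     forall s : 'S_n, NC s -> ev s (P F) = 0).
Proof.
split=> [f s|P dfP c pad_c c_neq0 F nF codeF s NCs]; first exact: ev_noncrossing.
have EQF := double_forest_EQSym dfP pad_c nF codeF.
rewrite (ev_noncrossing EQF NCs) ev1_at_t; last by case: EQF.
(* The value at [t] is 0 unless [F] is empty; the empty forest has zero code, contrary to
   [c_neq0]. *)
have [_ _ -> _] := dfP F nF; case: F codeF {nF EQF} => // codeF.
case/(has_nthP 0%N): c_neq0 => i _.
by have := codeF i.+1 isT; rewrite /= => <-.
Qed.
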